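(* Let $(r_n)_{n\ge 0}$ be a deterministic sequence with $0\le r_n<1$, and let $M=(M_n)_{n\ge 0}$ be a martingale with respect to a filtration $(\mathcal{G}_n)_{n\ge 0}$, taking values in $[0,1]$ and following the dynamics $$M_{n+1}=(1-r_n)M_n+r_nY_{n+1},\qquad n\ge 0,$$ where $Y_{n+1}$ is a random variable with values in $[0,1]$ and $E[Y_{n+1}\mid\mathcal{G}_n]=M_n$ a.s. Let $M_\infty$ be the almost sure limit of $(M_n)_n$. If $P(0<M_0<1)>0$ and $$r_n=O\Big(e^{-\sum_{k=0}^n r_k}\sum_{k=0}^n r_k\Big)\quad (n\to\infty),$$ then $$P(M_\infty=0\mid 0<M_0<1)=P(M_\infty=1\mid 0<M_0<1)=0.$$ *)

(* Defs.v *)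
From HB Require Import structures.
From mathcomp Require Import all_boot all_order all_algebra.
From mathcomp Require Import all_classical all_reals all_analysis.

Set Implicit Arguments.
Unset Strict Implicit.
Unset Printing Implicit Defensive.

Import Order.TTheory GRing.Theory Num.Theory.
Import numFieldNormedType.Exports.

Local Open Scope classical_set_scope.
Local Open Scope ring_scope.

Section Definitions.
Context {d : measure_display} {T : measurableType d} {R : realType}.

Definition sub_sigma_algebra (G : set (set T)) : Prop :=
  sigma_algebra setT G /\ G `<=` measurable.

Definition filtration (G : nat -> set (set T)) : Prop :=
  (forall n, sub_sigma_algebra (G n)) /\ (forall n, G n `<=` G n.+1).

Definition measurable_wrt (G : set (set T)) (f : T -> R) : Prop :=
  forall B : set R, measurable B -> G (f @^-1` B).

(* [Z] is a version of E[X | G].  As versions are only determined almost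
   surely, "E[X | G] = Z a.s." for a [G]-measurable [Z] is exactly this. *)
Definition is_cond_exp (P : probability T R) (G : set (set T)) (X Z : T -> R)
    : Prop :=
  [/\ P.-integrable setT (EFin \o X),
      P.-integrable setT (EFin \o Z),
      measurable_wrt G Z &
      forall A, G A ->
        (\int[P]_(x in A) (Z x)%:E = \int[P]_(x in A) (X x)%:E)%E].

Definition martingale (P : probability T R) (G : nat -> set (set T))
    (M : nat -> T -> R) : Prop :=
  [/\ forall n, measurable_wrt (G n) (M n),
      forall n, P.-integrable setT (EFin \o M n) &
      forall n, is_cond_exp P (G n) (M n.+1) (M n)].

(* P(A | B); only meaningful when P(B) > 0. *)
Definition cond_prob (P : probability T R) (A B : set T) : R :=
  fine (P (A `&` B)) / fine (P B).

End Definitions.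

(* Main.v *)
(** By the symmetry [M -> 1 - M] it is enough to exclude absorption at 0.
    Convexity in [Y_(n+1)] gives
    [E [exp (- y M_(n+1)) | G_n] <= exp (- F_n(y) M_n)] with
    [F_n(y) = (1 - r_n) y + 1 - exp (- r_n y)], so [exp (- mu_n M_n)] is a
    supermartingale as soon as [0 <= mu_n <= F_n(mu_(n+1))]. If for every [K]
    there is a bounded such sequence with [mu_0 >= K], then
    [P (M_oo = 0, M_0 > 0) <= E [exp (- K M_0) ; M_0 > 0]], which vanishes as
    [K] grows.

    Let [a_n = r_0 + ... + r_(n-1)] and [p_n = (1 - r_0) ... (1 - r_(n-1))]. The
    growth condition makes [\sum r_n^2] finite, hence [p_n] comparable to
    [exp (- a_n)]. If [a] is bounded, [mu_n = K / p_n] will do. Otherwise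
    [r_n <= C a_(n+1) p_(n+1)], and one takes [mu_n = lambda_n / p_n] up to a
    large time [m], with [lambda_n] constant at first and then
    [lambda_n = delta (4 / a_m + ln (a_m / a_n))]; from [m] on, [mu] increases by
    a multiple of [mu_m^2 r_n^2] and at most doubles, because
    [\sum_(n >= m) r_n^2 <= C (1 + a_m) p_m]. The divergence of [ln a_m] makes
    [mu_0] arbitrarily large. *)
Require Import Defs.
From HB Require Import structures.
From mathcomp Require Import all_boot all_order all_algebra.
From mathcomp Require Import all_classical all_reals all_analysis.
From mathcomp Require Import measurable_realfun ring lra.

Set Implicit Arguments.
Unset Strict Implicit.
Unset Printing Implicit Defensive.

Import Order.TTheory GRing.Theory Num.Theory.
Import numFieldNormedType.Exports.

Local Open Scope classical_set_scope.
Local Open Scope ring_scope.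

(** * Partial sums, square sums and products of the step sizes *)

Section Sums.
Context {R : realType} (r : nat -> R).

Definition cumul n := \sum_(0 <= k < n) r k.
Definition sqcumul n := \sum_(0 <= k < n) r k ^+ 2.
Definition shrink n := \prod_(0 <= k < n) (1 - r k).

Lemma cumulS n : cumul n.+1 = cumul n + r n.
Proof. by rewrite /cumul big_nat_recr. Qed.

Lemma sqcumulS n : sqcumul n.+1 = sqcumul n + r n ^+ 2.
Proof. by rewrite /sqcumul big_nat_recr. Qed.

Lemma shrinkS n : shrink n.+1 = shrink n * (1 - r n).
Proof. by rewrite /shrink big_nat_recr. Qed.

Context (r01 : forall n, 0 <= r n < 1).

Lemma cumul_ge0 n : 0 <= cumul n.
Proof. by apply: sumr_ge0 => k _; case/andP: (r01 k). Qed.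

Lemma cumul_nondecreasing m n : (m <= n)%N -> cumul m <= cumul n.
Proof.
elim: n => [|n IHn]; first by rewrite leqn0 => /eqP ->.
rewrite leq_eqVlt => /predU1P[->//|/IHn]; rewrite cumulS.
by move=> /le_trans; apply; rewrite lerDl; case/andP: (r01 n).
Qed.

Lemma sqcumul_nondecreasing m n : (m <= n)%N -> sqcumul m <= sqcumul n.
Proof.
elim: n => [|n IHn]; first by rewrite leqn0 => /eqP ->.
rewrite leq_eqVlt => /predU1P[->//|/IHn]; rewrite sqcumulS.
by move=> /le_trans; apply; rewrite lerDl sqr_ge0.
Qed.

Lemma shrink_gt0 n : 0 < shrink n.
Proof. by apply: prodr_gt0 => k _; rewrite subr_gt0; case/andP: (r01 k). Qed.

(** [v] is a potential whose decrease pays for the growth of [u]; both uses bound [sqcumul]. *)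
Lemma telescope_le (u v : nat -> R) m n :
  (m <= n)%N -> (forall k, (m <= k)%N -> u k.+1 + v k.+1 <= u k + v k) ->
  u n + v n <= u m + v m.
Proof.
move=> + uv; elim: n => [|n IHn]; first by rewrite leqn0 => /eqP ->.
rewrite leq_eqVlt => /predU1P[->//|mn].
by apply: le_trans (IHn mn); exact: uv.
Qed.

Context (C : R) (n0 : nat).
Context (C0 : 0 < C).
Context (rC : forall n, (n0 <= n)%N ->
  r n <= C * (expR (- cumul n.+1) * cumul n.+1)).

(* [r k ^+ 2 <= 2 C r k exp (- a_(k+1) / 2)], with [a] the partial sums of [r];
   this is dominated by the increments of [- 4 C exp (- a_k / 2)]. *)
Lemma sqcumul_bounded : exists B, forall n, sqcumul n <= B.
Proof.
exists (sqcumul n0 + 4 * C) => n; case: (leqP n0 n) => [n0n|/ltnW nn0]; last first.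
  by have := sqcumul_nondecreasing nn0; move: C0; lra.
have step k : (n0 <= k)%N ->
    sqcumul k.+1 + 4 * C * expR (- (cumul k.+1 / 2)) <=
    sqcumul k + 4 * C * expR (- (cumul k / 2)).
  move=> n0k; rewrite sqcumulS; set a := cumul k.+1.
  have a0 : 0 <= a by exact: cumul_ge0.
  set e := expR (- (a / 2)).
  have e0 : 0 < e by exact: expR_gt0.
  have eE : expR (- a) = e * e.
    by rewrite -expRD; congr expR; field.
  (* Half of the exponential decay absorbs the linear factor of the growth condition. *)
  have ea : e * a <= 2.
    have : e * (1 + a / 2) <= 1.
      by rewrite /e expRN mulrC ler_pdivrMr ?expR_gt0// mul1r expR_ge1Dx.
    nra.
  have -> : expR (- (cumul k / 2)) = e * expR (r k / 2).
    by rewrite -expRD /a cumulS; congr expR; field.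
  have er := expR_ge1Dx (r k / 2).
  have rk := rC n0k; rewrite -/a eE in rk.
  have /andP[rk0 rk1] := r01 k.
  have r2 : r k <= 2 * C * e.
    apply: le_trans rk _.
    have : 0 <= C * e * (2 - e * a) by rewrite !mulr_ge0 ?subr_ge0// ltW.
    by lra.
  have h1 : 0 <= (2 * C * e - r k) * r k by rewrite mulr_ge0 // subr_ge0.
  have h2 : 0 <= 4 * C * e * (expR (r k / 2) - (1 + r k / 2)).
    by rewrite !mulr_ge0 ?subr_ge0// ltW.
  by rewrite expr2; lra.
have := telescope_le (v := fun k => 4 * C * expR (- (cumul k / 2))) n0n step.
have : C * expR (- (cumul n0 / 2)) <= C.
  by rewrite ger_pMr// expR_le1 oppr_le0 divr_ge0 ?cumul_ge0.
have : 0 < C * expR (- (cumul n / 2)) by rewrite mulr_gt0 ?expR_gt0.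
by lra.
Qed.

Lemma r_small : exists n1, forall n, (n1 <= n)%N -> r n <= 2^-1.
Proof.
have [B hB] := sqcumul_bounded.
have cv : cvgn (series (fun n => r n ^+ 2)).
  apply: (@nondecreasing_is_cvgn R) => [m n mn|].
    exact: (sqcumul_nondecreasing mn).
  by exists B => _ [n _ <-]; exact: hB.
have /cvgrPdist_lt := cvg_series_cvg_0 cv.
move=> /(_ (4^-1)) []; first by lra.
move=> n1 _ h; exists n1 => n n1n; have := h n n1n => /=.
rewrite sub0r normrN ger0_norm ?sqr_ge0// expr2.
by have /andP[] := r01 n; nra.
Qed.

(** For [0 <= x <= 1/2], [1 - x >= exp (- (x + 2 x^2))]. Multiplied over the indices from [n1] on,
    the quadratic terms cost only the factor [exp (- 2 B)], since [sqcumul] is bounded. *)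
Lemma shrink_ge : exists2 c, 0 < c &
  exists n1, forall n, (n1 <= n)%N -> c * expR (- cumul n) <= shrink n.
Proof.
have [B hB] := sqcumul_bounded; have [n1 hn1] := r_small.
pose c := shrink n1 * expR (- (2 * B)).
exists c; first by rewrite mulr_gt0 ?shrink_gt0 ?expR_gt0.
exists n1 => n n1n.
suff h : shrink n1 * expR (- (cumul n + 2 * sqcumul n)) <= shrink n.
  apply: le_trans h; rewrite -mulrA -expRD ler_pM2l ?shrink_gt0// ler_expR.
  by have := hB n; lra.
elim: n n1n => [|n IHn].
  rewrite leqn0 => /eqP ->; rewrite /cumul /sqcumul !big_nil mulr0 addr0 oppr0.
  by rewrite expR0 mulr1.
rewrite leq_eqVlt => /predU1P[<-|n1n].
  rewrite ger_pMr ?shrink_gt0// expR_le1 oppr_le0.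
  rewrite addr_ge0 ?cumul_ge0// mulr_ge0// sumr_ge0// => k _.
  exact: sqr_ge0.
rewrite shrinkS cumulS sqcumulS.
have -> : - (cumul n + r n + 2 * (sqcumul n + r n ^+ 2)) =
  - (cumul n + 2 * sqcumul n) - (r n + 2 * r n ^+ 2) by ring.
rewrite expRD mulrA; have /andP[r0 r1] := r01 n; have r2 := hn1 _ n1n.
apply: ler_pM => //; first by rewrite mulr_ge0 ?ltW ?shrink_gt0 ?expR_gt0.
  exact: IHn.
rewrite expRN -ler_pV2 ?inE ?unitfE ?invr_eq0 ?gt_eqF ?invr_gt0 ?expR_gt0//= ?subr_gt0//.
rewrite invrK; apply: le_trans (expR_ge1Dx _).
rewrite -div1r ler_pdivrMr ?subr_gt0// expr2.
(* With [x = r n], [(1 + x + 2 x^2) (1 - x) = 1 + x^2 (1 - 2 x)]. *)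
have : 0 <= r n * r n * (1 - 2 * r n) by rewrite !mulr_ge0// subr_ge0; lra.
by nra.
Qed.

End Sums.

(** * Backward recursion for the Laplace parameters *)

Section Backward.
Context {R : realType} (r : nat -> R).
Context (r01 : forall n, 0 <= r n < 1).
(* In the application, [phi n x] is [E [exp (- x M_n) ; M_0 > 0]]. *)
Context (phi : nat -> R -> \bar R).
Context (phi_antitone : forall n x y, x <= y -> (phi n y <= phi n x)%E).
Context (phi_step : forall n y, 0 <= y ->
  (phi n.+1 y <= phi n ((1 - r n) * y + (1 - expR (- (r n * y)))))%E).

(** Going down from [n] to [m], each step applies [phi_step] and then lowers the argument to [mu k],
    which antitonicity allows. *)
Lemma phi_chain (mu : nat -> R) m n : (m <= n)%N ->
  (forall k, (m < k <= n)%N -> 0 <= mu k) ->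
  (forall k, (m <= k < n)%N ->
     mu k <= (1 - r k) * mu k.+1 + (1 - expR (- (r k * mu k.+1)))) ->
  (phi n (mu n) <= phi m (mu m))%E.
Proof.
elim: n => [|n IHn] mn mu0 hmu; first by move: mn; rewrite leqn0 => /eqP ->.
move: mn; rewrite leq_eqVlt => /predU1P[->//|mn].
apply: le_trans (IHn mn _ _).
- apply: le_trans (phi_step _ _) (phi_antitone _ _).
    by apply: mu0; rewrite leqnn mn.
  by apply: hmu; rewrite ltnS leqnn andbT.
- by move=> k /andP[mk kn]; apply: mu0; rewrite mk ltnW.
- by move=> k /andP[mk kn]; apply: hmu; rewrite mk ltnW.
Qed.

(** Dropping the nonnegative gain [1 - expR (- (r k * y))] leaves the recursion
    [mu k = (1 - r k) * mu k.+1], solved by [K / shrink r k]. *)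
Lemma phi_shrink K n : 0 <= K -> (phi n (K / shrink r n) <= phi 0%N K)%E.
Proof.
move=> K0; have {2}-> : K = K / shrink r 0 by rewrite /shrink big_nil divr1.
apply: (phi_chain (mu := fun k => K / shrink r k)) => // k _.
  by rewrite divr_ge0// ltW// shrink_gt0.
have /andP[r0 r1] := r01 k; have p0 := shrink_gt0 r01 k.
have -> : K / shrink r k = (1 - r k) * (K / shrink r k.+1).
  by rewrite shrinkS; field; rewrite !gt_eqF ?subr_gt0.
by rewrite lerDl subr_ge0 expR_le1 oppr_le0 mulr_ge0// divr_ge0// ltW// shrink_gt0.
Qed.

Lemma expRN_le (t : R) : 0 <= t -> expR (- t) <= (1 + t)^-1.
Proof.
move=> t0; rewrite expRN lef_pV2 ?posrE ?expR_gt0 ?expR_ge1Dx//.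
by rewrite ltr_pwDl.
Qed.

Context (C : R) (n0 : nat) (C0 : 0 < C).
Context (rC : forall n, (n0 <= n)%N -> r n <= C * cumul r n.+1 * shrink r n.+1).

(** The potential [C (1 + a_k) p_k] drops by exactly [C r_k a_(k+1) p_k], and the growth condition
    makes this at least [r_k^2]. *)
Lemma sqcumul_tail m n : (n0 <= m)%N -> (m <= n)%N ->
  sqcumul r n - sqcumul r m <= C * (1 + cumul r m) * shrink r m.
Proof.
move=> n0m mn.
have step k : (m <= k)%N ->
    sqcumul r k.+1 + C * (1 + cumul r k.+1) * shrink r k.+1 <=
    sqcumul r k + C * (1 + cumul r k) * shrink r k.
  move=> mk; have := rC (leq_trans n0m mk).
  rewrite sqcumulS cumulS shrinkS => rk.
  have /andP[r0 r1] := r01 k; have p0 := shrink_gt0 r01 k.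
  have a0 := cumul_ge0 r01 k.
  have h1 := ler_wpM2l r0 rk.
  have h2 : 0 <= r k ^+ 2 * C * (cumul r k + r k) * shrink r k.
    by rewrite !mulr_ge0 ?sqr_ge0 ?addr_ge0// ltW.
  by move: h1 h2; rewrite expr2; lra.
have := telescope_le (v := fun k => C * (1 + cumul r k) * shrink r k) mn step.
have : 0 <= C * (1 + cumul r n) * shrink r n.
  by rewrite !mulr_ge0 ?addr_ge0 ?cumul_ge0// ltW// shrink_gt0.
by lra.
Qed.

(** Since [1 - exp (- t) >= t - t^2], passing from [y] to [F_k(y)] loses at most [r_k^2 y^2], hence
    at most [4 x^2 r_k^2] while [y <= 2 x]. The last hypothesis keeps the accumulated loss at most
    [x]. *)
Lemma phi_tail m n x : (n0 <= m)%N -> (m <= n)%N -> 0 <= x ->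
  4 * x * (C * (1 + cumul r m) * shrink r m) <= 1 ->
  (phi n (2 * x) <= phi m x)%E.
Proof.
move=> n0m mn x0 hx.
pose mu k := x + 4 * x ^+ 2 * (sqcumul r k - sqcumul r m).
have mu2 k : (m <= k)%N -> x <= mu k <= 2 * x.
  move=> mk; have t0 := sqcumul_nondecreasing r mk.
  have t1 := sqcumul_tail n0m mk; rewrite /mu lerDl; apply/andP; split.
    by rewrite !mulr_ge0 ?sqr_ge0 ?subr_ge0.
  have h1 : 4 * x * (sqcumul r k - sqcumul r m) <= 1.
    by apply: le_trans hx; rewrite ler_wpM2l// mulr_ge0.
  by have := ler_wpM2l x0 h1; rewrite expr2; lra.
have <- : mu m = x by rewrite /mu subrr mulr0 addr0.
apply: (@le_trans _ _ (phi n (mu n))).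
  apply: phi_antitone; have -> : mu m = x by rewrite /mu subrr mulr0 addr0.
  by case/andP: (mu2 n mn).
apply: phi_chain => // k /andP[mk kn].
  by case/andP: (mu2 k (ltnW mk)) => /(le_trans x0).
have /andP[y1 y2] := mu2 k.+1 (leqW mk).
have -> : mu k = mu k.+1 - 4 * x ^+ 2 * r k ^+ 2.
  by rewrite /mu sqcumulS; ring.
set y := mu k.+1 in y1 y2 *; have /andP[r0 r1] := r01 k.
have t0 : 0 <= r k * y by rewrite mulr_ge0// (le_trans x0).
have : (1 + r k * y)^-1 <= 1 - r k * y + (r k * y) ^+ 2.
  rewrite -div1r ler_pdivrMr ?ltr_pwDl//.
  by have := mulr_ge0 (sqr_ge0 (r k * y)) t0; rewrite expr2; lra.
have : y ^+ 2 * r k ^+ 2 <= (2 * x) ^+ 2 * r k ^+ 2.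
  by rewrite ler_wpM2r ?sqr_ge0// lerXn2r ?nnegrE ?mulr_ge0// (le_trans x0).
by have := expRN_le t0; rewrite !expr2; lra.
Qed.

(* The start value of [phi_tail] is reached backwards from [m] with
   [mu k = lam k / shrink r k]: as [lam k.+1 >= 4 d / cumul r k.+1], the gain
   [1 - expR (- (r k * mu k.+1))] pays for the logarithmic increment of [lam]. *)
Lemma phi_window n1 m (K : R) : (n0 <= n1)%N -> (n1 <= m)%N -> 4 <= cumul r n1 ->
  32 * C * K <= ln (cumul r m / cumul r n1) ->
  (phi m ((8 * C * cumul r m * shrink r m)^-1) <= phi n1 (K / shrink r n1))%E.
Proof.
move=> n01 n1m A4 hK.
(* With this [d], [lam m / shrink r m] is the argument of [phi m] in the conclusion, and the
   hypothesis on [ln] gives [lam n1 >= K]. *)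
pose d := (32 * C)^-1.
have d0 : 0 < d by rewrite invr_gt0 mulr_gt0.
have dC : d * C = 32^-1 by rewrite /d; field; rewrite gt_eqF.
pose lam k := d * (4 / cumul r m + ln (cumul r m / cumul r k)).
have A4k k : (n1 <= k)%N -> 4 <= cumul r k.
  by move=> n1k; apply: le_trans A4 (cumul_nondecreasing r01 n1k).
(* From [ln (b / a) >= 1 - a / b], what remains is [(b - a) (a - 4) / (a b) >= 0], which uses
   [a >= 4]. *)
have lamge k : (n1 <= k)%N -> (k <= m)%N -> 4 * d / cumul r k <= lam k.
  move=> n1k km; have := A4k k n1k; have := A4k m n1m.
  have := cumul_nondecreasing r01 km; rewrite /lam.
  set a := cumul r k; set b := cumul r m => ab b4 a4.
  have a0 : 0 < a by lra.
  have b0 : 0 < b by lra.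
  have : ln (1 + (a / b - 1)) <= a / b - 1.
    by apply: le_ln1Dx; have := divr_gt0 a0 b0; lra.
  have -> : 1 + (a / b - 1) = (b / a)^-1 by field; rewrite !gt_eqF.
  rewrite lnV ?posrE ?divr_gt0// => lnb.
  have -> : 4 * d / a = d * (4 / a) by field; rewrite gt_eqF.
  rewrite ler_pM2l//.
  suff : 4 / a <= 4 / b + (1 - a / b) by lra.
  have -> : 4 / b + (1 - a / b) = 4 / a + (b - a) * (a - 4) / (a * b).
    by field; rewrite !gt_eqF.
  by rewrite lerDl divr_ge0// mulr_ge0 ?subr_ge0// ltW.
have lamm : lam m / shrink r m = (8 * C * cumul r m * shrink r m)^-1.
  have Am : 0 < cumul r m by have := A4k m n1m; lra.
  have pm := shrink_gt0 r01 m.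
  rewrite /lam divff ?gt_eqF// ln1 addr0 /d; field.
  by rewrite !gt_eqF.
rewrite -lamm.
apply: (@le_trans _ _ (phi n1 (lam n1 / shrink r n1))); last first.
  apply: phi_antitone; rewrite ler_pM2r ?invr_gt0 ?shrink_gt0//.
  rewrite /lam mulrC -ler_pdivrMr// /d invrK.
  apply: le_trans (_ : ln (cumul r m / cumul r n1) <= _); first by lra.
  by rewrite lerDr divr_ge0// (le_trans _ (A4k m n1m)).
apply: (phi_chain (mu := fun k => lam k / shrink r k)) => // k /andP[nk kn].
  rewrite divr_ge0 ?(ltW (shrink_gt0 _ _))// (le_trans _ (lamge k (ltnW nk) kn))//.
  by rewrite divr_ge0 ?mulr_ge0 ?(ltW d0)// (le_trans _ (A4k k (ltnW nk))).
have := lamge k.+1 (leqW nk) kn; have := A4k k nk.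
have := rC (leq_trans n01 nk).
have : lam k - lam k.+1 = d * ln (cumul r k.+1 / cumul r k).
  have ak : 0 < cumul r k by have := A4k k nk; lra.
  have ak1 : 0 < cumul r k.+1 by have := A4k k.+1 (leqW nk); lra.
  have am : 0 < cumul r m by have := A4k m n1m; lra.
  by rewrite /lam !ln_div ?posrE//; ring.
have p0 := shrink_gt0 r01 k; have /andP[r0 r1] := r01 k.
rewrite cumulS shrinkS.
set l := lam k.+1; set a := cumul r k; set p := shrink r k.
set s := a + r k => lamk rk a4 hl.
have a0 : 0 < a by lra.
have s0 : 0 < s by rewrite /s; lra.
have r1' : 0 < 1 - r k by rewrite subr_gt0.
have l0 : 0 <= l by apply: le_trans hl; rewrite divr_ge0 ?mulr_ge0// ltW.
have lnle : ln (s / a) <= r k / a.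
  have -> : s / a = 1 + r k / a by rewrite /s; field; rewrite gt_eqF.
  by apply: le_ln1Dx; apply: lt_le_trans (divr_ge0 r0 (ltW a0)); lra.
(* [s <= 2 a] because [r k < 1 <= a], so [ln (s / a) <= r k / a <= 2 r k / s]. *)
have D : lam k <= l + 2 * d * r k / s.
  suff : d * ln (s / a) <= 2 * d * r k / s by lra.
  have -> : 2 * d * r k / s = d * (2 * r k / s) by field; rewrite gt_eqF.
  rewrite ler_pM2l// (le_trans lnle)// ler_pdivrMr// mulrAC ler_pdivlMr//.
  by rewrite /s; have := mulr_ge0 r0 (ltW a0); nra.
(* [t = r k * mu k.+1] is the exponent in the gain at step [k]. *)
pose t := r k * (l / (p * (1 - r k))).
have t0 : 0 <= t by rewrite mulr_ge0// divr_ge0// mulr_ge0// ltW.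
have tp : t * (p * (1 - r k)) = r k * l.
  by rewrite /t; field; rewrite !gt_eqF.
have tC : t <= C * s * l.
  rewrite /t mulrA ler_pdivrMr ?mulr_gt0//.
  by have := ler_wpM2r l0 rk; lra.
have lE : (1 - r k) * (l / (p * (1 - r k))) = l / p.
  by field; rewrite !gt_eqF.
rewrite lE -/t.
(* The increment of [lam], divided by [p], must not exceed the guaranteed gain [t / (1 + t)]. In
   [2 d (1 + t)], the constant part is at most [l s / 2] by [lamge], and the part in [t] at most
   [l s / 16] by [tC]. *)
have key : 2 * d * r k / s * (1 + t) <= p * t.
  have z4 : 4 * d <= l * s by rewrite -ler_pdivrMr.
  have : 2 * d * (1 + t) <= l * s.
    have : 2 * d * t <= 2 * (d * C) * (s * l).
      by have := ler_wpM2l (ltW d0) tC; lra.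
    by rewrite dC; lra.
  move=> /(ler_wpM2l r0) h.
  have h2 : 2 * d * r k / s * (1 + t) <= r k * l.
    by rewrite mulrAC ler_pdivrMr//; lra.
  apply: le_trans h2 _; rewrite -tp.
  have : 0 <= t * p * r k by rewrite mulr_ge0// mulr_ge0// ltW.
  by lra.
have h3 : 2 * d * r k / s / p <= 1 - (1 + t)^-1.
  have -> : 1 - (1 + t)^-1 = t / (1 + t) by field; rewrite gt_eqF// ltr_pwDl.
  by rewrite ler_pdivlMr ?ltr_pwDl// mulrAC ler_pdivrMr// [t * p]mulrC.
have h4 : lam k / p <= l / p + 2 * d * r k / s / p.
  by rewrite -mulrDl ler_pM2r ?invr_gt0.
by have := expRN_le t0; lra.
Qed.

End Backward.

(** [theta] does not depend on [n], so the limit in [n] can be taken at a fixed parameter. Only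
    monotonicity and the one-step inequality of [phi] enter here; the probability comes later. *)
Lemma phi_forces_large {R : realType} (r : nat -> R) (phi : nat -> R -> \bar R)
    (C : R) (n0 : nat) :
  (forall n, 0 <= r n < 1) ->
  0 < C ->
  (forall n, (n0 <= n)%N -> r n <= C * (expR (- cumul r n.+1) * cumul r n.+1)) ->
  (forall n x y, x <= y -> (phi n y <= phi n x)%E) ->
  (forall n y, 0 <= y ->
    (phi n.+1 y <= phi n ((1 - r n) * y + (1 - expR (- (r n * y))))%R)%E) ->
  forall K, 0 <= K -> exists theta, exists N, forall n, (N <= n)%N ->
    (phi n theta <= phi 0%N K)%E.
Proof.
move=> r01 C0 rC anti step K K0.
have [c c0 [n1 hc]] := shrink_ge r01 C0 rC.
have [[B hB]|unb] := pselect (exists B, forall n, cumul r n <= B).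
  (* As [shrink r n >= c * expR (- B)] from [n1] on, this [theta] dominates every [K / shrink r n]
     there. *)
  exists (K / (c * expR (- B))), n1 => n n1n.
  apply: le_trans (phi_shrink r01 anti step n K0); apply: anti.
  rewrite ler_wpM2l// lef_pV2 ?posrE ?shrink_gt0 ?mulr_gt0 ?expR_gt0//.
  by apply: le_trans (hc n n1n); rewrite ler_pM2l// ler_expR lerN2.
have {}unb B : exists n, B < cumul r n.
  apply: contrapT => h; apply: unb; exists B => n.
  by rewrite leNgt; apply/negP => ?; apply: h; exists n.
pose n2 := maxn n0 n1.
(* By [shrink_ge], the product replaces the exponential at the cost of a factor [1 / c]. *)
have [C' C'0 rC'] : exists2 C', 0 < C' & forall n, (n2 <= n)%N ->
    r n <= C' * cumul r n.+1 * shrink r n.+1.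
  exists (C / c) => [|n]; first by rewrite divr_gt0.
  rewrite geq_max => /andP[n0n n1n]; apply: le_trans (rC n n0n) _.
  have : expR (- cumul r n.+1) <= shrink r n.+1 / c.
    by rewrite ler_pdivlMr// mulrC; exact: hc (leqW n1n).
  move=> /(ler_wpM2l (mulr_ge0 (ltW C0) (cumul_ge0 r01 n.+1))) h.
  rewrite [expR _ * _]mulrC mulrA (le_trans h)//.
  by rewrite le_eqVlt; apply/orP; left; apply/eqP; ring.
have [n3' hn3'] := unb 4; pose n3 := maxn n2 n3'.
have A4 : 4 <= cumul r n3.
  exact: le_trans (ltW hn3') (cumul_nondecreasing r01 (leq_maxr _ _)).
have n23 : (n2 <= n3)%N by exact: leq_maxl.
have A0 : 0 < cumul r n3 by lra.
(* [m] is so large that [ln (a_m / a_n3) >= 32 C' K], as [phi_window] requires. *)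
have [m hm] := unb (cumul r n3 * expR (32 * C' * K)).
have E1 : 1 <= expR (32 * C' * K).
  by rewrite -expR0 ler_expR !mulr_ge0// ltW.
have n3m : (n3 <= m)%N.
  rewrite leqNgt; apply/negP => /ltnW /(cumul_nondecreasing r01) h.
  by have := ler_wpM2l (ltW A0) E1; lra.
have Am : 4 <= cumul r m by apply: le_trans A4 (cumul_nondecreasing r01 n3m).
have Am0 : 0 < cumul r m by lra.
have pm0 := shrink_gt0 r01 m.
(* Here the window meets the tail: [4 x C' (1 + a_m) p_m = (1 + a_m) / (2 a_m) <= 1]. *)
pose x := (8 * C' * cumul r m * shrink r m)^-1.
have x0 : 0 < x by rewrite invr_gt0 !mulr_gt0.
exists (2 * x), m => n mn.
apply: le_trans (phi_tail r01 anti step C'0 rC' (leq_trans n23 n3m) mn (ltW x0) _) _.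
  have xE : x * (8 * C' * cumul r m * shrink r m) = 1.
    by rewrite /x mulVf// gt_eqF// !mulr_gt0.
  have : 0 <= x * C' * shrink r m * (cumul r m - 1).
    rewrite mulr_ge0 ?subr_ge0//; last by lra.
    by rewrite mulr_ge0 ?ltW// mulr_gt0.
  by lra.
apply: le_trans (phi_shrink r01 anti step n3 K0).
apply: (phi_window r01 anti step C'0 rC' n23 n3m A4).
rewrite -ler_expR lnK ?posrE ?divr_gt0// ler_pdivlMr// mulrC.
exact: ltW.
Qed.

(** * Staircase approximation *)

Section Floor.
Context {R : realType}.

(** For [y >= 0] this is the minimum of [n] and the integer part of [y], written as a sum of
    indicators so that integrals weighted by it split over level sets. *)
Definition level_count (y : R) n : R := \sum_(j < n) (j.+1%:R <= y)%R%:R.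

Lemma level_count_full (y : R) n : n%:R <= y -> level_count y n = n%:R.
Proof.
move=> ny; rewrite /level_count.
rewrite (eq_bigr (fun _ => 1)) ?sumr_const ?card_ord// => i _.
by rewrite (le_trans _ ny)// ler_nat.
Qed.

Lemma level_count_bounds (y : R) n : 0 <= y <= n%:R ->
  level_count y n <= y <= level_count y n + 1.
Proof.
elim: n => [|n IHn] /andP[y0 yn].
  by rewrite /level_count big_ord0 add0r y0 (le_trans yn).
rewrite /level_count big_ord_recr/= -/(level_count y n).
have [yn'|yn'] := leP y n%:R.
  have -> : (n.+1%:R <= y) = false.
    by apply/negbTE; rewrite -ltNge (le_lt_trans yn')// ltr_nat.
  by rewrite addr0; apply: IHn; rewrite y0.
rewrite (level_count_full (ltW yn')).
rewrite -[n.+1%:R]natr1 in yn *.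
by case: (boolP (n%:R + 1 <= y)) => [|_] /=; rewrite ?addr0; lra.
Qed.

End Floor.

(** * The one-step inequality under conditioning *)

Section Conditional.
Context {d : measure_display} {T : measurableType d} {R : realType}.
Context (P : probability T R).

Lemma sub_sigma_algebraI (G : set (set T)) (A B : set T) :
  Defs.sub_sigma_algebra G -> G A -> G B -> G (A `&` B).
Proof.
move=> [sG _] GA GB; rewrite -(sigma_algebra_id sG).
by apply: (@measurableI _ (g_sigma_algebraType G)); apply: sub_sigma_algebra.
Qed.

Lemma measurable_wrt_measurable (G : set (set T)) (f : T -> R) :
  Defs.sub_sigma_algebra G -> measurable_wrt G f -> measurable_fun setT f.
Proof. by move=> [_ sG] mf _ B mB; rewrite setTI; apply: sG; exact: mf. Qed.

(* [Z] is approximated from below, up to [1 / k], by [1 / k] times the number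
   of levels [(j + 1) / k], [j < k], that it exceeds. *)
Lemma integral_weighted_le (G : set (set T)) (f h Z : T -> R) (A : set T) :
  Defs.sub_sigma_algebra G ->
  measurable_fun setT f -> measurable_fun setT h ->
  (forall w, 0 <= f w <= 1) -> (forall w, 0 <= h w <= 1) ->
  (forall B, G B -> (\int[P]_(w in B) (f w)%:E = \int[P]_(w in B) (h w)%:E)%E) ->
  measurable_wrt G Z -> (forall w, 0 <= Z w <= 1) -> G A ->
  (\int[P]_(w in A) (Z w * f w)%:E <= \int[P]_(w in A) (Z w * h w)%:E)%E.
Proof.
move=> sG mf mh f01 h01 fh GZ Z01 GA.
have mA : measurable A by exact: sG.2.
have mZ := measurable_wrt_measurable sG GZ.
have mT (g : T -> R) : measurable_fun setT g -> measurable_fun A g.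
  by move=> mg; apply: measurable_funS mg.
apply/lee_addgt0Pr => e e0.
(* With mesh [1 / k < e], replacing [Z] by its staircase costs at most [e] in the integral, as
   [f <= 1] and [P A <= 1]. *)
pose k := (Num.Def.archi_bound e^-1).
have ke : e^-1 < k%:R :> R by apply: archi_boundP; rewrite invr_ge0 ltW.
have k0 : 0 < k%:R :> R by apply: lt_trans ke; rewrite invr_gt0.
pose E (j : 'I_k) := Z @^-1` [set x | j.+1%:R <= k%:R * x].
have GE j : G (E j).
  apply: GZ.
  rewrite (_ : [set x | _] = `[(j.+1%:R / k%:R), +oo[%classic)//.
  by apply/seteqP; split => x /=; rewrite in_itv/= andbT ler_pdivrMr// mulrC.
pose app (g : T -> R) w := (\sum_(j < k) (k%:R^-1)%:E * ((EFin \o g) \_ (E j)) w)%E.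
have appE g w : app g w = (level_count (k%:R * Z w) k / k%:R * g w)%:E.
  rewrite /app /level_count mulr_suml mulr_suml -sumEFin.
  apply: eq_bigr => j _; rewrite patchE.
  rewrite (_ : (w \in E j) = (j.+1%:R <= k%:R * Z w)); last first.
    by apply/idP/idP; rewrite inE.
  by case: ifP => _; rewrite -EFinM ?mul1r// mulr0 !mul0r.
have mapp (g : T -> R) : measurable_fun setT g -> measurable_fun A (app g).
  move=> mg; apply: emeasurable_sum => j.
  apply: emeasurable_funM; first exact: measurable_cst.
  apply/(measurable_restrict _ (sG.2 _ (GE j)) mA).
  by apply/measurable_EFinP; apply: measurable_funS mg.
have iapp (g : T -> R) : measurable_fun setT g -> (forall w, 0 <= g w <= 1) ->
    (\int[P]_(w in A) app g w =
     \sum_(j < k) (k%:R^-1)%:E * \int[P]_(w in A `&` E j) (g w)%:E)%E.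
  move=> mg g01.
  have mgE j : measurable_fun A ((EFin \o g) \_ (E j)).
    apply/(measurable_restrict _ (sG.2 _ (GE j)) mA).
    by apply/measurable_EFinP; apply: measurable_funS mg.
  have gE0 j w : (0 <= ((EFin \o g) \_ (E j)) w)%E.
    by rewrite patchE; case: ifP => // _; rewrite lee_fin; case/andP: (g01 w).
  rewrite ge0_integral_sum//.
  - apply: eq_bigr => j _; rewrite ge0_integralZl_EFin// ?invr_ge0 ?ler0n//.
    by rewrite -integral_mkcondr.
  - by move=> j; apply: emeasurable_funM => //; exact: measurable_cst.
  - by move=> j w _; rewrite mule_ge0// lee_fin invr_ge0 ler0n.
have lc w : level_count (k%:R * Z w) k / k%:R <= Z w <=
    level_count (k%:R * Z w) k / k%:R + k%:R^-1.
  have /andP[z0 z1] := Z01 w.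
  have := @level_count_bounds R (k%:R * Z w) k.
  rewrite mulr_ge0 ?ler0n// ger_pMr// => /(_ z1) /andP[l1 l2].
  by rewrite ler_pdivrMr// -[X in _ + X]mul1r -mulrDl ler_pdivlMr// [Z w * _]mulrC l1.
have lc0 w : 0 <= level_count (k%:R * Z w) k by apply: sumr_ge0.
have mM (g : T -> R) : measurable_fun setT g -> measurable_fun A (fun w => (Z w * g w)%:E).
  move=> mg; apply/measurable_EFinP; apply: measurable_funM; exact: mT.
apply: (@le_trans _ _ (\int[P]_(w in A) (app f w + e%:E))%E).
  apply: ge0_le_integral => //.
  - move=> w _; rewrite lee_fin mulr_ge0//; first by case/andP: (Z01 w).
    by case/andP: (f01 w).
  - exact: mM.
  - by apply: emeasurable_funD; [exact: mapp|exact: measurable_cst].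
  - move=> w _; rewrite appE -EFinD lee_fin.
    have /andP[_ h1] := lc w; have /andP[f0 f1] := f01 w.
    have : k%:R^-1 <= e by rewrite -[e]invrK lef_pV2 ?posrE ?invr_gt0 ?ltW.
    move=> h2; apply: le_trans (ler_wpM2r f0 h1) _.
    rewrite mulrDl lerD2l (le_trans _ h2)// ger_pMr// ?invr_gt0//.
rewrite ge0_integralD//; first last.
- by move=> w _; rewrite lee_fin ltW.
- exact: mapp.
- move=> w _; rewrite appE lee_fin mulr_ge0 ?divr_ge0//.
  by case/andP: (f01 w).
rewrite integral_cst//; apply: leeD.
  (* The staircase involves only integrals over [A] intersected with [E j]; these sets belong to
     [G], so [fh] exchanges [f] and [h]. *)
  have -> : (\int[P]_(w in A) app f w = \int[P]_(w in A) app h w)%E.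
    rewrite !iapp//; apply: eq_bigr => j _; congr (_ * _)%E; apply: fh.
    exact: sub_sigma_algebraI.
  apply: ge0_le_integral => //.
  - move=> w _; rewrite appE lee_fin mulr_ge0 ?divr_ge0//.
    by case/andP: (h01 w).
  - exact: mapp.
  - exact: mM.
  - move=> w _; rewrite appE lee_fin ler_wpM2r//; first by case/andP: (h01 w).
    by case/andP: (lc w).
by rewrite -[leRHS]mule1 lee_wpmul2l ?probability_le1// lee_fin ltW.
Qed.

(* The tangent of [expR] at [- (c * y)], evaluated at [0] and at [- c]. *)
Lemma expR_chord (c y : R) : 0 <= y <= 1 ->
  expR (- (c * y)) <= 1 - y * (1 - expR (- c)).
Proof.
move=> /andP[y0 y1]; set v := - (c * y).
have tangent x : expR v * (1 + (x - v)) <= expR x.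
  by rewrite -[in leRHS](subrKC v x) expRD ler_pM2l ?expR_gt0// expR_ge1Dx.
have := ler_wpM2l y0 (tangent (- c)).
have := tangent 0; rewrite expR0.
have y1' : 0 <= 1 - y by rewrite subr_ge0.
have ev : expR v * v = - (expR v * (c * y)) by rewrite {2}/v mulrN.
by move=> /(ler_wpM2l y1'); lra.
Qed.

(** With [c = 1 - exp (- r y)], the chord bound makes the new factor linear in [Y], conditioning
    replaces [Y] by [M] under the [G]-measurable weight [Z], and [1 - c M <= exp (- c M)] returns to
    an exponential. *)
Lemma laplace_step (G : set (set T)) (A : set T) (M M' Y : T -> R) (r y : R) :
  Defs.sub_sigma_algebra G -> G A -> measurable_wrt G M ->
  measurable_fun setT M' -> measurable_fun setT Y ->
  (forall w, 0 <= M w <= 1) -> (forall w, 0 <= Y w <= 1) ->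
  (forall w, M' w = (1 - r) * M w + r * Y w) ->
  (forall B, G B -> (\int[P]_(w in B) (M w)%:E = \int[P]_(w in B) (Y w)%:E)%E) ->
  0 <= r < 1 -> 0 <= y ->
  (\int[P]_(w in A) (expR (- (y * M' w)))%:E <=
   \int[P]_(w in A)
     (expR (- (((1 - r) * y + (1 - expR (- (r * y)))) * M w)))%:E)%E.
Proof.
move=> sG GA GM mM' mY M01 Y01 dyn MY /andP[r0 r1] y0.
have mA : measurable A by exact: sG.2.
have mM := measurable_wrt_measurable sG GM.
pose c := 1 - expR (- (r * y)).
have c0 : 0 <= c by rewrite subr_ge0 expR_le1 oppr_le0 mulr_ge0.
pose Z w := expR (- ((1 - r) * y * M w)).
have ry0 : 0 <= (1 - r) * y by rewrite mulr_ge0// subr_ge0 ltW.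
have mexp d' (T' : measurableType d') (a : R) (g : T' -> R) : measurable_fun setT g ->
    measurable_fun setT (fun w => expR (- (a * g w))).
  move=> mg; apply: measurableT_comp => //; apply: measurableT_comp => //.
  by apply: measurable_funM => //; exact: measurable_cst.
have mE (g : T -> R) : measurable_fun setT g ->
    measurable_fun A (fun w => (g w)%:E).
  by move=> mg; apply/measurable_EFinP; apply: measurable_funS mg.
have GZ : measurable_wrt G Z.
  have me : measurable_fun setT (fun x : R => expR (- ((1 - r) * y * x))).
    exact: (mexp _ _ _ _ (@measurable_id _ _ setT)).
  by move=> B mB; have := GM _ (me measurableT _ mB); rewrite setTI.
have Z01 w : 0 <= Z w <= 1.
  rewrite expR_ge0 expR_le1 oppr_le0 mulr_ge0//.
  by case/andP: (M01 w).
have le := integral_weighted_le sG mM mY M01 Y01 MY GZ Z01 GA.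
have mZ := measurable_wrt_measurable sG GZ.
have mZY : measurable_fun setT (fun w => Z w * Y w) by exact: measurable_funM.
have mZM : measurable_fun setT (fun w => Z w * M w) by exact: measurable_funM.
have ZY01 w : 0 <= Z w * Y w <= 1.
  have /andP[z0 z1] := Z01 w; have /andP[u0 u1] := Y01 w.
  by rewrite mulr_ge0//= mulr_ile1.
have ZM0 w : 0 <= Z w * M w.
  have /andP[z0 z1] := Z01 w; have /andP[u0 u1] := M01 w.
  by rewrite mulr_ge0.
have fin : (c%:E * \int[P]_(w in A) (Z w * Y w)%:E)%E \is a fin_num.
  rewrite fin_numM// integrable_fin_num//.
  apply: (le_integrable mA) (finite_measure_integrable_cst P 1 mA).
  - exact: mE.
  - move=> w _; rewrite /= lee_fin normr1 ger0_norm; by case/andP: (ZY01 w).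
(* The finite quantity [c] times the integral of [Z * Y] is added to both sides, so that no integral
   has to be subtracted. *)
rewrite -(leeD2rE _ _ fin).
set F := (1 - r) * y + c.
apply: (@le_trans _ _ (\int[P]_(w in A) (Z w)%:E)%E).
  rewrite -ge0_integralZl_EFin//; first last.
  - exact: mE.
  - by move=> w _; rewrite lee_fin; case/andP: (ZY01 w).
  rewrite -ge0_integralD//; first last.
  - apply: emeasurable_funM; first exact: measurable_cst.
    exact: mE.
  - by move=> w _; rewrite mule_ge0// lee_fin//; case/andP: (ZY01 w).
  - by apply: mE; exact: mexp.
  apply: ge0_le_integral => //.
  - move=> w _; rewrite adde_ge0 ?mule_ge0// lee_fin ?expR_ge0//.
    by case/andP: (ZY01 w).
  - apply: emeasurable_funD; first by apply: mE; exact: mexp.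
    apply: emeasurable_funM; first exact: measurable_cst.
    exact: mE.
  - exact: mE.
  - move=> w _; rewrite -EFinM -EFinD lee_fin dyn.
    have -> : - (y * ((1 - r) * M w + r * Y w)) =
      - ((1 - r) * y * M w) + - (r * y * Y w) by ring.
    rewrite expRD -/(Z w).
    have /andP[z0 _] := Z01 w.
    have := ler_wpM2l z0 (expR_chord (r * y) (Y01 w)); rewrite -/c; lra.
apply: (@le_trans _ _ (\int[P]_(w in A) ((expR (- (F * M w)))%:E +
    c%:E * (Z w * M w)%:E))%E).
  apply: ge0_le_integral => //.
  - by move=> w _; rewrite lee_fin expR_ge0.
  - exact: mE.
  - apply: emeasurable_funD; first by apply: mE; exact: mexp.
    apply: emeasurable_funM; first exact: measurable_cst.
    exact: mE.
  - move=> w _; rewrite -EFinM -EFinD lee_fin.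
    have -> : - (F * M w) = - ((1 - r) * y * M w) + - (c * M w).
      by rewrite /F /c; ring.
    rewrite expRD -/(Z w).
    have /andP[z0 _] := Z01 w.
    by have := ler_wpM2l z0 (expR_ge1Dx (- (c * M w))); lra.
rewrite ge0_integralD//; first last.
- apply: emeasurable_funM; first exact: measurable_cst.
  exact: mE.
- by move=> w _; rewrite mule_ge0// lee_fin.
- by apply: mE; exact: mexp.
rewrite leeD2l// ge0_integralZl_EFin//; first by rewrite lee_wpmul2l// lee_fin.
- by move=> w _; rewrite lee_fin.
- exact: mE.
Qed.

End Conditional.

(** * Absorption at zero has probability zero *)

Lemma absorption_at_zero_null {d : measure_display} {T : measurableType d}
    {R : realType} (P : probability T R) (G : nat -> set (set T))
    (r : nat -> R) (M Y : nat -> T -> R) (Minf : T -> R) (C : R) (n0 : nat) :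
  (forall n, 0 <= r n < 1) ->
  0 < C ->
  (forall n, (n0 <= n)%N -> r n <= C * (expR (- cumul r n.+1) * cumul r n.+1)) ->
  Defs.filtration G ->
  (forall n, measurable_wrt (G n) (M n)) ->
  (forall n w, 0 <= M n w <= 1) ->
  (forall n, measurable_fun setT (Y n)) ->
  (forall n w, 0 <= Y n.+1 w <= 1) ->
  (forall n w, M n.+1 w = (1 - r n) * M n w + r n * Y n.+1 w) ->
  (forall n B, G n B ->
    (\int[P]_(w in B) (M n w)%:E = \int[P]_(w in B) (Y n.+1 w)%:E)%E) ->
  measurable_fun setT Minf ->
  {ae P, forall w, M n w @[n --> \oo] --> Minf w} ->
  (P ([set w | (Minf w = 0)%R] `&` [set w | (0 < M 0%N w)%R]) = 0)%E.
Proof.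
move=> r01 C0 rC [sG GS] GM M01 mY Y01 dyn MY mMinf cvM.
set A := [set w | 0 < M 0%N w]; set E := [set w | Minf w = 0].
(* [A] lies in [G 0], hence in every [G n], so restricting to [A] is compatible with each
   conditioning step. *)
have GA n : G n A.
  elim: n => [|n IHn]; last exact: GS.
  rewrite (_ : A = M 0%N @^-1` `]0, +oo[%classic); first exact: GM.
  by apply/seteqP; split => w /=; rewrite in_itv/= andbT.
have mA : measurable A by exact: (sG 0%N).2.
have mM n : measurable_fun setT (M n).
  exact: measurable_wrt_measurable (sG n) (GM n).
have mE : measurable E.
  by rewrite -[E]setTI; exact: (mMinf measurableT _ (measurable_set1 0)).
have mexp (a : R) (g : T -> R) : measurable_fun setT g ->
    measurable_fun A (fun w => (expR (- (a * g w)))%:E).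
  move=> mg; apply/measurable_EFinP; apply: measurable_funS measurableT _ _ => //.
  apply: measurableT_comp => //; apply: measurableT_comp => //.
  by apply: measurable_funM => //; exact: measurable_cst.
pose phi n x := (\int[P]_(w in A) (expR (- (x * M n w)))%:E)%E.
have anti n x y : x <= y -> (phi n y <= phi n x)%E.
  move=> xy; apply: ge0_le_integral => //.
  - exact: mexp.
  - exact: mexp.
  - move=> w _; rewrite lee_fin ler_expR lerN2 ler_wpM2r//.
    by case/andP: (M01 n w).
have step n y : 0 <= y ->
    (phi n.+1 y <= phi n ((1 - r n) * y + (1 - expR (- (r n * y))))%R)%E.
  by move=> y0; apply: (laplace_step (sG n) (GA n) (GM n) (mM n.+1) (mY n.+1)
    (M01 n) (Y01 n) (dyn n) (MY n) (r01 n) y0).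
have bound K : 0 <= K -> (P (E `&` A) <= phi 0%N K)%E.
  move=> K0.
  have [theta [N hN]] := phi_forces_large r01 C0 rC anti step K0.
  (* [theta] comes without a sign, so the dominating constant is the exponential of its absolute
     value. *)
  have cv : (phi n theta @[n --> \oo] -->
      \int[P]_(w in A) (expR (- (theta * Minf w)))%:E)%E.
    have [|||||_ _ //] := @dominated_convergence _ _ _ P A mA
      (fun n w => (expR (- (theta * M n w)))%:E)
      (fun w => (expR (- (theta * Minf w)))%:E)
      (EFin \o cst (expR `|theta|)).
    - by move=> n; exact: mexp.
    - exact: mexp.
    - move: cvM; apply: filterS => w cvw _.
      apply: cvg_EFin; first by near=> n.
      apply: (@continuous_cvg _ _ _ _ _ (fun n => - (theta * M n w)) expR).
        exact: continuous_expR.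
      by apply: cvgN; apply: cvgMr.
    - exact: finite_measure_integrable_cst.
    - apply: aeW => w n _; rewrite /= lee_fin ger0_norm ?expR_ge0// ler_expR.
      have /andP[m0 m1] := M01 n w.
      rewrite -mulNr (le_trans (ler_norm _))// normrM normrN (ger0_norm m0).
      by rewrite ler_piMr.
  (* On [E] the limiting integrand is [1]. *)
  apply: (@le_trans _ _ (\int[P]_(w in A) (expR (- (theta * Minf w)))%:E)%E).
    rewrite -integral_indic//; apply: ge0_le_integral => //.
    - by apply/measurable_EFinP; exact: measurable_indic.
    - exact: mexp.
    - move=> w _; rewrite lee_fin indicE.
      case: (boolP (w \in E)) => [|_]; last by rewrite expR_ge0.
      by rewrite inE /E/= => ->; rewrite mulr0 oppr0 expR0.
  apply: (cvge_to_le cv); exists N => // n; exact: hN.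
(* On [A], [expR (- M 0 w)] is below [1], so its powers tend to [0]. *)
have cv : (phi 0%N n%:R @[n --> \oo] --> \int[P]_(w in A) 0)%E.
  have [|||||_ _ //] := @dominated_convergence _ _ _ P A mA
    (fun n w => (expR (- (n%:R * M 0%N w)))%:E) (cst 0%E) (EFin \o cst 1).
  - by move=> n; exact: mexp.
  - exact: measurable_cst.
  - apply: aeW => w Aw; apply: cvg_EFin; first by near=> n.
    rewrite (_ : _ \o _ = GRing.exp (expR (- M 0%N w))); last first.
      by apply/funext => n /=; rewrite -mulrN expRM_natl.
    apply: cvg_expr; rewrite ger0_norm ?expR_ge0//.
    by rewrite -expR0 ltr_expR oppr_lt0.
  - exact: finite_measure_integrable_cst.
  - apply: aeW => w n _; rewrite /= lee_fin ger0_norm ?expR_ge0// expR_le1.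
    by rewrite oppr_le0 mulr_ge0//; case/andP: (M01 0%N w).
apply/eqP; rewrite eq_le measure_ge0 andbT.
rewrite integral0 in cv.
by apply: (cvge_ge _ cv); near=> n; exact: bound.
Unshelve. all: by end_near. Qed.

(** * Both endpoints, by symmetry *)

Theorem theorem2p2 (R : realType) (d : measure_display) (T : measurableType d)
    (P : probability T R) (r : nat -> R) (G : nat -> set (set T))
    (M : nat -> T -> R) (Y : nat -> {RV P >-> R}) (Minf : {RV P >-> R})
    (hr : forall n, 0 <= r n < 1)
    (hG : filtration G)
    (hM : martingale P G M)
    (hM01 : forall n w, 0 <= M n w <= 1)
    (hY01 : forall n w, 0 <= Y n.+1 w <= 1)
    (hdyn : forall n w, M n.+1 w = (1 - r n) * M n w + r n * Y n.+1 w)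
    (hYM : forall n, is_cond_exp P (G n) (Y n.+1) (M n))
    (hMinf : {ae P, forall w, (M n w @[n --> \oo]) --> Minf w})
    (hM0 : (0 < P [set w | (0 < M 0%N w < 1)%R])%E)
    (hrO : r =O_\oo (fun n =>
             expR (- \sum_(0 <= k < n.+1) r k) * \sum_(0 <= k < n.+1) r k)) :
  cond_prob P [set w | Minf w = 0] [set w | 0 < M 0%N w < 1] = 0 /\
  cond_prob P [set w | Minf w = 1] [set w | 0 < M 0%N w < 1] = 0.

Proof.
have [C C0 [n0 _ hC]] := (eqO_exP _ _ _).1 hrO.
have rC n : (n0 <= n)%N -> r n <= C * (expR (- cumul r n.+1) * cumul r n.+1).
  move=> n0n; have := hC n n0n; rewrite /= ger0_norm; last by case/andP: (hr n).
  by rewrite ger0_norm// mulr_ge0 ?expR_ge0// (cumul_ge0 hr).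
have [sG GS] := hG; have [GM _ _] := hM.
have mM n : measurable_fun setT (M n).
  exact: measurable_wrt_measurable (sG n) (GM n).
have mY n : measurable_fun setT (Y n) by exact: measurable_funPT.
have mMinf : measurable_fun setT Minf by exact: measurable_funPT.
have MY n B : G n B ->
    (\int[P]_(w in B) (M n w)%:E = \int[P]_(w in B) (Y n.+1 w)%:E)%E.
  by move=> GB; have [_ _ _] := hYM n; exact.
have zero := absorption_at_zero_null hr C0 rC hG GM hM01 mY hY01 hdyn MY mMinf hMinf.
(* [1 - M] follows the same dynamics with [1 - Y], and its absorption at [0] is that of [M] at
   [1]. *)
have one : (P ([set w | (1 - Minf w = 0)%R] `&` [set w | (0 < 1 - M 0%N w)%R]) = 0)%E.
  apply: (@absorption_at_zero_null _ _ _ _ G r (fun n w => 1 - M n w)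
    (fun n w => 1 - Y n w) _ C n0) => //.
  - move=> n B mB.
    have m1 : measurable_fun setT (fun x : R => 1 - x).
      by apply: measurable_funB => //; exact: measurable_cst.
    by have := GM n _ (m1 measurableT _ mB); rewrite setTI.
  - by move=> n w; have := hM01 n w; lra.
  - by move=> n; apply: measurable_funB => //; exact: measurable_cst.
  - by move=> n w; have := hY01 n w; lra.
  - by move=> n w; rewrite hdyn; ring.
  - move=> n B GB; have mB : measurable B by exact: (sG n).2.
    have int1 (f : T -> R) : P.-integrable setT (EFin \o f) ->
        (\int[P]_(w in B) (1 - f w)%:E = P B - \int[P]_(w in B) (f w)%:E)%E.
      move=> /(integrableS measurableT mB (@subsetT _ _)) fi.
      under eq_integral do rewrite EFinB.
      rewrite integralB//; last exact: (finite_measure_integrable_cst P 1 mB).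
      by rewrite integral_cst// mul1e.
    by have [iY iM _ _] := hYM n; rewrite !int1// MY.
  - by apply: measurable_funB => //; exact: measurable_cst.
  - move: hMinf; apply: filterS => w cw.
    by apply: cvgB => //; exact: cvg_cst.
have mpre (f : T -> R) (S : set R) : measurable_fun setT f -> measurable S ->
    measurable (f @^-1` S).
  by move=> mf mS; rewrite -[_ @^-1` _]setTI; exact: mf.
have mA c : measurable [set w | Minf w = c] by exact: mpre (measurable_set1 c).
have mB : measurable [set w | 0 < M 0%N w].
  rewrite (_ : [set w | _] = M 0%N @^-1` `]0, +oo[%classic); first exact: mpre.
  by apply/seteqP; split => w /=; rewrite in_itv/= andbT.
have mB' : measurable [set w | M 0%N w < 1].
  rewrite (_ : [set w | _] = M 0%N @^-1` `]-oo, 1[%classic); first exact: mpre.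
  by apply/seteqP; split => w /=; rewrite in_itv.
have mBB' : measurable [set w | 0 < M 0%N w < 1].
  rewrite (_ : [set w | _] = [set w | 0 < M 0%N w] `&` [set w | M 0%N w < 1]).
    exact: measurableI.
  by apply/seteqP; split => w /= => [/andP[]|[-> ->]].
(* The numerator is the measure of a subset of a null event. *)
have cond0 A B : measurable A -> measurable B -> P (A `&` B) = 0 ->
    [set w | 0 < M 0%N w < 1] `<=` B ->
    cond_prob P A [set w | 0 < M 0%N w < 1] = 0.
  move=> mA' mB1 AB0 sub; rewrite /cond_prob.
  rewrite (_ : P (A `&` _) = 0) ?mul0r//.
  apply: (subset_measure0 _ _ _ AB0); [exact: measurableI|exact: measurableI|].
  exact: setIS.
split; first by apply: cond0 zero _ => // w /andP[].
apply: cond0 (mA 1) mB' _ _ => [|w /andP[]//].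
rewrite -one; congr (P (_ `&` _)); apply/seteqP; split => w /=.
- by move=> ->; rewrite subrr.
- by move/eqP; rewrite subr_eq0 => /eqP.
- by rewrite subr_gt0.
- by rewrite subr_gt0.
Qed.
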